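(* Let $T$ be a regular set of patterns and $n\ge1$. Any two consecutive permutations in the list $\mathcal{C}_n$ (directions ignored) differ in at most five positions.
   Context: $\mathfrak{S}_n(T)$ is the set of permutations of $\{1,\ldots,n\}$ avoiding (in the usual pattern sense) every pattern in $T$. The sites of $\pi\in\mathfrak{S}_n$ are the $n+1$ gaps between consecutive entries, before the first and after the last entry, numbered from right to left $1,\ldots,n+1$. For $\pi\in\mathfrak{S}_n(T)$, site $i$ is active if inserting $n+1$ into site $i$ gives a permutation in $\mathfrak{S}_{n+1}(T)$. $T$ is regular if for every $n\ge1$ and every $\pi\in\mathfrak{S}_n(T)$: $\pi$ has at least two active sites and they are right justified (every site to the right of an active site is active, so the active sites are $1,\ldots,k$); and the number of active sites of the permutation obtained by inserting $n+1$ into the $i$-th active site of $\pi$ depends only on $i$ and the number $k$ of active sites of $\pi$. A directed permutation is a pair $\pi^i$ of a permutation $\pi$ and a direction $i\in\{0,1\}$ ($1$ = up, $0$ = down). For $k\ge2$, let $L_k$ be $1,3,5,\ldots,k,k-1,k-3,\ldots,4,2$ if $k$ is odd and $1,3,5,\ldots,k-1,k,k-2,\ldots,4,2$ if $k$ is even. For $\pi\in\mathfrak{S}_n(T)$ with $k$ active sites, $\phi(\pi^1)$ is the list of $k$ directed permutations whose $j$-th element is $\pi$ with $n+1$ inserted into its $L_k(j)$-th active site, the first having direction $1$ and all others direction $0$; $\phi(\pi^0)$ is the reversal of $\phi(\pi^1)$ with every direction flipped. $\phi$ extends to lists by concatenation. Let $d_n=|\mathfrak{S}_n(T)|$, $\mathcal{C}_1=((1)^1)$,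 and $\mathcal{C}_n=\bigoplus_{q=1}^{d_{n-1}}\phi(\mathcal{C}_{n-1}(q))$ for $n\ge2$, where $\mathcal{C}_{n-1}(q)$ is the $q$-th directed permutation of $\mathcal{C}_{n-1}$ and $\bigoplus$ is list concatenation in index order. *)

(* Defs.v *)
From mathcomp Require Import all_boot.
From mathcomp Require Import boolp classical_sets.

Set Implicit Arguments.
Unset Strict Implicit.
Unset Printing Implicit Defensive.

(* A permutation of {1, ..., n} is given in one-line notation, as a sequence
   of natural numbers that is a rearrangement of iota 1 n = [:: 1; ...; n]. *)
Definition is_perm (n : nat) (p : seq nat) : bool := perm_eq p (iota 1 n).

Definition order_isomorphic (s t : seq nat) : Prop :=
  size s = size t /\
  forall i j, i < size t -> j < size t ->
    (nth 0 s i < nth 0 s j) = (nth 0 t i < nth 0 t j).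

Definition contains (p tau : seq nat) : Prop :=
  exists2 s, subseq s p & order_isomorphic s tau.

Definition pattern_set (T : set (seq nat)) : Prop :=
  forall tau, T tau -> is_perm (size tau) tau.

Definition avoiders (T : set (seq nat)) (n : nat) (p : seq nat) : Prop :=
  is_perm n p /\ forall tau, T tau -> ~ contains p tau.

(* Sites are numbered from right to left starting from 1: exactly i.-1 entries
   of p end up to the right of the new maximum. *)
Definition insert_max (p : seq nat) (i : nat) : seq nat :=
  let m := size p - i.-1 in take m p ++ (size p).+1 :: drop m p.

Definition active (T : set (seq nat)) (p : seq nat) (i : nat) : bool :=
  `[< avoiders T (size p).+1 (insert_max p i) >].

Definition active_sites (T : set (seq nat)) (p : seq nat) : seq nat :=
  [seq i <- iota 1 (size p).+1 | active T p i].

Definition nb_active (T : set (seq nat)) (p : seq nat) : nat :=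
  size (active_sites T p).

Definition insert_active (T : set (seq nat)) (p : seq nat) (j : nat) : seq nat :=
  insert_max p (nth 0 (active_sites T p) j.-1).

Definition right_justified (T : set (seq nat)) (p : seq nat) : Prop :=
  forall i j, 1 <= j -> j <= i -> i <= (size p).+1 ->
    active T p i -> active T p j.

(* The succession function chi is uniform in n and in p. *)
Definition regular (T : set (seq nat)) : Prop :=
  (forall n p, 1 <= n -> avoiders T n p ->
     2 <= nb_active T p /\ right_justified T p) /\
  exists chi : nat -> nat -> nat,
    forall n p i, 1 <= n -> avoiders T n p -> 1 <= i <= nb_active T p ->
      nb_active T (insert_active T p i) = chi i (nb_active T p).

(* The odd numbers up to k in increasing order, then the even ones in
   decreasing order. *)
Definition L (k : nat) : seq nat :=
  [seq i <- iota 1 k | odd i] ++ rev [seq i <- iota 1 k | ~~ odd i].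

(* The direction is true for up (1) and false for down (0). *)
Definition dperm : Type := (seq nat * bool)%type.

Definition phi_up (T : set (seq nat)) (p : seq nat) : seq dperm :=
  let ps := [seq insert_active T p j | j <- L (nb_active T p)] in
  zip ps (true :: nseq (size ps).-1 false).

Definition phi (T : set (seq nat)) (d : dperm) : seq dperm :=
  if d.2 then phi_up T d.1
  else rev [seq (x.1, ~~ x.2) | x <- phi_up T d.1].

Definition nb_avoiders (T : set (seq nat)) (n : nat) : nat :=
  size [seq p <- permutations (iota 1 n) | `[< avoiders T n p >]].

Definition dperm0 : dperm := ([::], false).

(* Only the values at n >= 1 are meaningful. *)
Fixpoint gray_list (T : set (seq nat)) (n : nat) : seq dperm :=
  match n with
  | 0 => [::]
  | 1 => [:: ([:: 1], true)]
  | m.+1 => \big[cat/[::]]_(1 <= q < (nb_avoiders T m).+1)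
              phi T (nth dperm0 (gray_list T m) q.-1)
  end.

Definition nb_diff (n : nat) (p r : seq nat) : nat :=
  #|[pred i : 'I_n | nth 0 p i != nth 0 r i]|.

(* Main.v *)
(* Siblings in the generating tree receive n+1 in sites at distance at most 2, so
   they differ in at most three positions. A list phi(pi^i) starts with a
   permutation directed up and ends with one directed down, so consecutive
   permutations with different parents are always directed (down, up); then the
   two lists they generate meet at site 1 on both sides, and the number of
   differences is never increased again. Pairs directed (up, down) likewise meet at
   site 2, and only equal directions, which occur among siblings, put n+1 in
   sites 1 and 2, at a cost of at most two more differences. Hence consecutive
   permutations differ in at most three positions, or five if directed
   (down, up). *)

Require Import Defs.
From mathcomp Require Import all_boot.
From mathcomp Require Import boolp classical_sets.
From mathcomp Require Import zify.

Set Implicit Arguments.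
Unset Strict Implicit.
Unset Printing Implicit Defensive.

(** * Hamming distance of sequences *)

Definition hamming (s t : seq nat) : nat := count (fun x => x.1 != x.2) (zip s t).

(** The list form splits along concatenations, unlike the count over ordinals; since [zip]
    truncates, the lengths have to agree. *)
Lemma nb_diffE n s t : size s = n -> size t = n -> nb_diff n s t = hamming s t.
Proof.
move=> hs ht; rewrite /nb_diff /hamming -sum1_card.
have -> : zip s t = [seq (nth 0 s i, nth 0 t i) | i <- iota 0 n].
  apply: (@eq_from_nth _ (0, 0)) => [|i].
    by rewrite size_map size_iota size_zip hs ht minnn.
  rewrite size_zip hs ht minnn => i_lt.
  by rewrite nth_zip ?hs ?ht // (nth_map 0) ?size_iota // nth_iota.
rewrite count_map -sum1_count /=.
by rewrite -(big_mkord (fun i => nth 0 s i != nth 0 t i) (fun=> 1)) /index_iota subn0.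
Qed.

Lemma hammingC s t : hamming s t = hamming t s.
Proof.
by elim: s t => [|x s IHs] [|y t] //; move: (IHs t); rewrite /hamming /= eq_sym => ->.
Qed.

Lemma hamming_refl s : hamming s s = 0.
Proof. by elim: s => // x s; rewrite /hamming /= eqxx. Qed.

Lemma hamming_cat s1 s2 t1 t2 :
  size s1 = size t1 -> hamming (s1 ++ s2) (t1 ++ t2) = hamming s1 t1 + hamming s2 t2.
Proof. by move=> h; rewrite /hamming zip_cat // count_cat. Qed.

Lemma hamming_take_drop m s t :
    size s = size t ->
  hamming s t = hamming (take m s) (take m t) + hamming (drop m s) (drop m t).
Proof. by move=> h; rewrite -hamming_cat ?cat_take_drop // !size_take h. Qed.

Lemma hamming_size s t : hamming s t <= size s.
Proof.
by apply: leq_trans (count_size _ _) _; rewrite size_zip geq_minl.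
Qed.

(** * Insertion of a new maximum *)

Lemma size_insert_max p i : size (insert_max p i) = (size p).+1.
Proof.
by rewrite /insert_max size_cat /= size_drop size_take; case: ltnP; lia.
Qed.

Lemma hamming_insert_same p r i :
  size p = size r -> hamming (insert_max p i) (insert_max r i) = hamming p r.
Proof.
move=> h; rewrite /insert_max -h; set m := _ - _.
have hm : size (take m p) = size (take m r) by rewrite !size_take h.
rewrite hamming_cat // (hamming_take_drop m h).
by rewrite {2}/hamming /= eqxx.
Qed.

(** Outside the window between the two insertion points, the same entries of [p] and [r] stay
    aligned; the window has at most [(j - i).+1] positions. *)
Lemma hamming_insert_leq p r i j :
    size p = size r -> i <= j ->
  hamming (insert_max p i) (insert_max r j) <= hamming p r + (j - i).+1.
Proof.
move=> h ij; rewrite /insert_max -h.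
set m := size p - i.-1; set l := size p - j.-1.
have lm : l <= m by rewrite /l /m; lia.
have hl : size (take l p) = size (take l r) by rewrite !size_take h.
have splitm (s : seq nat) : take m s = take l s ++ drop l (take m s).
  by rewrite -{1}(cat_take_drop l (take m s)) take_takel.
have splitl (s : seq nat) : drop l s = drop l (take m s) ++ drop m s.
  by rewrite -{1}(cat_take_drop (m - l) (drop l s)) take_drop drop_drop subnK.
have hb (s : seq nat) : size s = size p -> size (drop l (take m s)) = m - l.
  by move=> hs; rewrite size_drop size_takel // hs /m; lia.
rewrite splitm (splitl r) -catA hamming_cat //.
rewrite (hamming_take_drop l h) -!addnA leq_add2l.
rewrite (splitl p) (splitl r) (@hamming_cat _ (drop m p)) ?hb // -cat_rcons -cat_cons.
rewrite hamming_cat; last by rewrite size_rcons /= !hb.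
have := hamming_size (rcons (drop l (take m p)) (size p).+1)
                     ((size p).+1 :: drop l (take m r)).
rewrite size_rcons hb //.
have : m - l <= j - i by rewrite /m /l; lia.
lia.
Qed.

(** * The zigzag order of the sites *)

Definition close (i j : nat) : bool := (i <= j + 2) && (j <= i + 2).

Lemma filter_iotaS (a : pred nat) k :
  filter a (iota 1 k.+1) = filter a (iota 1 k) ++ (if a k.+1 then [:: k.+1] else [::]).
Proof. by rewrite -[in LHS](addn1 k) iotaD filter_cat /= add1n. Qed.

(** The bounds keep [x] within 2 of the largest listed number, if any, which is [k] or [k.-1]
    according to parity. *)
Lemma path_close_parity b k x :
    k <= x <= k.+1 + (odd k == b) ->
  path close x (rev [seq i <- iota 1 k | odd i == b]).
Proof.
elim: k x => [//|k IHk] x; rewrite filter_iotaS rev_cat /=.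
have -> : (~~ odd k == b) = ~~ (odd k == b) by case: (odd k); case: b {IHk}.
case e: (odd k == b) => /= hx; first by apply: IHk; rewrite e; lia.
by rewrite IHk ?e ?andbT /close; lia.
Qed.

Lemma L_sorted k : sorted close (L k).
Proof.
case: k => [//|k].
(* Whatever its parity, [k.+1] is the turning point; both halves, the first one read backwards,
   descend from it in steps of 2. *)
have -> : L k.+1 = [seq i <- iota 1 k | odd i == true] ++
                   k.+1 :: rev [seq i <- iota 1 k | odd i == false].
  rewrite /L !filter_iotaS rev_cat.
  rewrite (@eq_filter _ odd (fun i => odd i == true)); last by move=> i; case: odd.
  rewrite (@eq_filter _ (fun i => ~~ odd i) (fun i => odd i == false)); last first.
    by move=> i; case: odd.
  by case: (odd k.+1); rewrite ?cats0 -?catA.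
rewrite sorted_cat_cons path_close_parity ?andbT; last by lia.
have closeC i j : close j i = close i j by rewrite /close andbC.
rewrite -rev_sorted rev_rcons /= (eq_path (e' := close)) //.
by apply: path_close_parity; lia.
Qed.

Lemma L_perm k : perm_eq (L k) (iota 1 k).
Proof.
by rewrite perm_sym -(perm_filterC odd) /L perm_cat2l perm_sym perm_rev.
Qed.

Lemma L_ends k : 2 <= k -> exists M, L k = 1 :: rcons M 2.
Proof.
case: k => [|[|k]] // _; rewrite /L /= rev_cons.
by eexists; rewrite -rcons_cat.
Qed.

(** * Active sites and the lists of children *)

Lemma filter_iota_initial (a : pred nat) N :
    (forall i j, 1 <= j -> j <= i -> i <= N -> a i -> a j) ->
  [seq i <- iota 1 N | a i] = iota 1 (size [seq i <- iota 1 N | a i]).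
Proof.
elim: N => [//|N IHN] mono; case aN: (a N.+1).
  have /all_filterP -> : all a (iota 1 N.+1).
    apply/allP => i; rewrite mem_iota => /andP[i1 i2].
    by apply: mono aN => //; lia.
  by rewrite size_iota.
rewrite filter_iotaS aN cats0; apply: IHN => i j *.
by apply: (mono i j) => //; lia.
Qed.

Definition tractable (T : set (seq nat)) (p : seq nat) : Prop :=
  2 <= nb_active T p /\ right_justified T p.

Lemma active_sitesE T p :
  right_justified T p -> active_sites T p = iota 1 (nb_active T p).
Proof. by move=> rj; apply: filter_iota_initial => i j *; apply: (rj i j). Qed.

Lemma insert_activeE T p j :
  right_justified T p -> 1 <= j <= nb_active T p -> insert_active T p j = insert_max p j.
Proof.
move=> rj hj; rewrite /insert_active active_sitesE // nth_iota; last by lia.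
by congr insert_max; lia.
Qed.

Lemma mem_L k j : (j \in L k) = (1 <= j <= k).
Proof. by rewrite (perm_mem (L_perm k)) mem_iota add1n. Qed.

Lemma phi_upE T p : tractable T p ->
  exists M, phi_up T p = (insert_max p 1, true) :: rcons M (insert_max p 2, false) /\
    unzip1 (phi_up T p) = [seq insert_max p j | j <- L (nb_active T p)].
Proof.
move=> [k_ge2 rj]; rewrite /phi_up.
have -> : [seq insert_active T p j | j <- L (nb_active T p)] =
          [seq insert_max p j | j <- L (nb_active T p)].
  by apply/eq_in_map => j; rewrite mem_L; apply: insert_activeE.
have [M eL] := L_ends k_ge2; eexists; split; last first.
  by rewrite unzip1_zip //= size_nseq; case: (size _).
rewrite eL /= map_rcons size_rcons size_map.
have -> : nseq (size M).+1 false = rcons (nseq (size M) false) false.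
  by rewrite -cats1 -(nseqD _ 1) addn1.
by rewrite zip_rcons ?size_map ?size_nseq.
Qed.

Lemma unzip1_phi T d : tractable T d.1 ->
  unzip1 (phi T d) = let s := [seq insert_max d.1 j | j <- L (nb_active T d.1)] in
                     if d.2 then s else rev s.
Proof.
case: d => p [] /phi_upE[M [_ /= h]] //.
by rewrite /phi /= /unzip1 map_rev -map_comp -h.
Qed.

(** Reversal exchanges the two ends and the flip exchanges their directions, so only the sites
    depend on [d.2]. *)
Lemma phi_ends T d : tractable T d.1 ->
  exists M, phi T d = (insert_max d.1 (if d.2 then 1 else 2), true)
                      :: rcons M (insert_max d.1 (if d.2 then 2 else 1), false).
Proof.
case: d => p [] /phi_upE[M [h _]]; rewrite /phi /= h; first by exists M.
by rewrite /= map_rcons rev_cons rev_rcons /=; eexists.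
Qed.

(** * Distances along the concatenated lists *)

Definition adjacent (d e : dperm) : bool :=
  hamming d.1 e.1 <= 3 + (~~ d.2 && e.2).*2.

Lemma insert_max_close p i j :
  close i j -> hamming (insert_max p i) (insert_max p j) <= 3.
Proof.
rewrite /close => /andP[h1 h2].
case: (leqP i j) => [ij|/ltnW ij]; last rewrite hammingC.
all: have := hamming_insert_leq (erefl (size p)) ij; rewrite hamming_refl; lia.
Qed.

(** Among siblings the bound 3 holds regardless of directions and is symmetric, so it survives
    reversal, whereas [adjacent] is not symmetric. *)
Lemma phi_sorted T d : tractable T d.1 -> sorted adjacent (phi T d).
Proof.
move=> good; pose e s t := hamming s t <= 3.
have eC : (fun s t => e t s) =2 e by move=> s t; rewrite /e hammingC.
have up : sorted e [seq insert_max d.1 j | j <- L (nb_active T d.1)].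
  rewrite sorted_map; apply: sub_sorted (L_sorted _) => i j.
  exact: insert_max_close.
have : sorted e (unzip1 (phi T d)).
  rewrite unzip1_phi //=; case: d.2 => //.
  by rewrite rev_sorted (eq_sorted eC).
rewrite sorted_map; apply: sub_sorted => x y; rewrite /adjacent /= /e; lia.
Qed.

(** The new pair is directed (down, up), so 5 is allowed: equal directions give at most 3 + 2,
    opposite ones keep the old distance. *)
Lemma adjacent_phi T d e : tractable T d.1 -> tractable T e.1 ->
    size d.1 = size e.1 -> adjacent d e ->
  adjacent (last dperm0 (phi T d)) (head dperm0 (phi T e)).
Proof.
move=> /phi_ends[M' ->] /phi_ends[N' ->] h; rewrite /adjacent /= last_rcons /=.
case: d.2; case: e.2 => /= ade; rewrite ?hamming_insert_same //.
- rewrite hammingC; move: ade; rewrite hammingC => ade.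
  have := @hamming_insert_leq e.1 d.1 1 2 (esym h) isT; lia.
- exact: leq_trans ade _.
- have := @hamming_insert_leq d.1 e.1 1 2 h isT; lia.
Qed.

Lemma flatten_phi_sorted T n s :
    (forall d, d \in s -> tractable T d.1 /\ size d.1 = n) ->
  sorted adjacent s -> sorted adjacent (flatten [seq phi T d | d <- s]).
Proof.
elim: s => [//|d [|e s] IHs] good.
  by move=> _; rewrite /= cats0; apply: phi_sorted; apply: (good d _).1; rewrite inE.
move=> /= /andP[ade srt].
have [gd hd] := good d (mem_head _ _).
have [|ge he] := good e; first by rewrite !inE eqxx orbT.
have {IHs} := IHs (fun x xs => good x (@mem_behead _ [:: d, e & s] x xs)) srt.
have := adjacent_phi gd ge (etrans hd (esym he)) ade.
have := phi_sorted gd; rewrite /=.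
(* Both lists are non-empty, so the only new junction is between the last child of [d] and the first
   child of [e]. *)
have [M ->] := phi_ends gd; have [N ->] := phi_ends ge.
by rewrite /= !cat_path /= => -> ->; rewrite cat_path.
Qed.

(** * Parents and children in the generating tree *)

Lemma avoiders_size T n p : avoiders T n p -> size p = n.
Proof. by case=> /perm_size; rewrite size_iota. Qed.

Lemma avoiders_mem T n p i : avoiders T n p -> (i \in p) = (1 <= i <= n).
Proof. by case=> /perm_mem ->; rewrite mem_iota add1n. Qed.

Lemma avoiders_uniq T n p : avoiders T n p -> uniq p.
Proof. by case=> /perm_uniq ->; rewrite iota_uniq. Qed.

(** The parent in the generating tree. As a filter it yields a subsequence, so avoidance is
    inherited. *)
Definition remove_max (p : seq nat) : seq nat := filter (predC1 (size p)) p.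

Lemma remove_insert_max T n p i : avoiders T n p -> remove_max (insert_max p i) = p.
Proof.
move=> av; rewrite /remove_max size_insert_max (avoiders_size av) /insert_max.
rewrite (avoiders_size av) filter_cat /= eqxx /= -filter_cat cat_take_drop.
apply/all_filterP/allP => j; rewrite (avoiders_mem _ av) /=; lia.
Qed.

(** The position of the maximum determines the site. The bounds exclude site 0, which acts as site
    1, and sites where the subtraction truncates. *)
Lemma insert_max_inj p i j :
    1 <= i <= (size p).+1 -> 1 <= j <= (size p).+1 -> (size p).+1 \notin p ->
  insert_max p i = insert_max p j -> i = j.
Proof.
move=> hi hj pN /(congr1 (index (size p).+1)).
have idx k : index (size p).+1 (insert_max p k) = size p - k.-1.
  rewrite /insert_max index_cat /= eqxx addn0 ifN ?size_takel ?leq_subr //.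
  by apply: contra pN; apply: mem_take.
by rewrite !idx; lia.
Qed.

Lemma remove_max_avoiders T n p :
  avoiders T n.+1 p -> avoiders T n (remove_max p).
Proof.
move=> av; rewrite /remove_max (avoiders_size av).
split=> [|tau /(av.2 tau) nc [s sp iso]]; last first.
  by apply: nc; exists s => //; apply: subseq_trans sp (filter_subseq _ _).
apply: uniq_perm; rewrite ?filter_uniq ?iota_uniq ?(avoiders_uniq av) // => i.
rewrite mem_filter (avoiders_mem _ av) mem_iota /=; lia.
Qed.

Lemma insert_remove_max T n p : avoiders T n.+1 p ->
  exists2 i, 1 <= i <= n.+1 & insert_max (remove_max p) i = p.
Proof.
move=> av; have := avoiders_size (remove_max_avoiders av).
have := avoiders_uniq av; have := avoiders_size av.
have : n.+1 \in p by rewrite (avoiders_mem _ av) /=.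
case/splitPr => a b.
rewrite cat_uniq /= negb_or size_cat /= addnS => -[sz] /and4P[_ /andP[aN _] bN _].
have -> : remove_max (a ++ n.+1 :: b) = a ++ b.
  rewrite /remove_max size_cat /= addnS sz filter_cat /= eqxx /= -filter_cat.
  apply/all_filterP/allP => x; rewrite mem_cat /=.
  by case/orP => xab; apply: contraTneq xab => ->.
(* Sites are counted from the right starting at 1, and [size b] entries lie to the right of the
   maximum. *)
move=> _; exists (size b).+1; first by rewrite /= ltnS -sz leq_addl.
by rewrite /insert_max size_cat /= addnK take_size_cat // drop_size_cat // sz.
Qed.

(** Conversely to insertion, an avoider is recovered by reinserting its maximum into its parent, so
    that site is active. *)
Lemma mem_unzip1_phi T n d x : tractable T d.1 -> avoiders T n d.1 ->
  (x \in unzip1 (phi T d)) <-> (avoiders T n.+1 x /\ remove_max x = d.1).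
Proof.
move=> good av; have [k_ge2 rj] := good; rewrite unzip1_phi //=.
have -> : (x \in if d.2 then [seq insert_max d.1 j | j <- L (nb_active T d.1)]
      else rev [seq insert_max d.1 j | j <- L (nb_active T d.1)]) =
      (x \in [seq insert_max d.1 j | j <- active_sites T d.1]).
  rewrite active_sitesE //; by case: d.2; rewrite ?mem_rev;
     exact/perm_mem/perm_map/L_perm.
split=> [/mapP[j]|[avx <-]].
  rewrite mem_filter => /andP[/asboolP act _] ->; rewrite -(avoiders_size av).
  by split; rewrite ?(remove_insert_max _ av).
have [i hi ei] := insert_remove_max avx; apply/mapP; exists i => //.
rewrite mem_filter mem_iota (avoiders_size (remove_max_avoiders avx)) hi andbT.
by apply/asboolP; rewrite ei (avoiders_size (remove_max_avoiders avx)).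
Qed.

Lemma uniq_unzip1_phi T n d :
  tractable T d.1 -> avoiders T n d.1 -> uniq (unzip1 (phi T d)).
Proof.
move=> good av; have [k_ge2 rj] := good; rewrite unzip1_phi //=.
have : uniq [seq insert_max d.1 j | j <- L (nb_active T d.1)].
  rewrite map_inj_in_uniq ?(perm_uniq (L_perm _)) ?iota_uniq // => i j.
  have le_k : nb_active T d.1 <= (size d.1).+1.
    by rewrite /nb_active size_filter (leq_trans (count_size _ _)) ?size_iota.
  rewrite !mem_L => /andP[i1 ik] /andP[j1 jk]; apply: insert_max_inj.
  - by rewrite i1 (leq_trans ik).
  - by rewrite j1 (leq_trans jk).
  by rewrite (avoiders_mem _ av) (avoiders_size av) ltnn andbF.
by case: d.2; rewrite ?rev_uniq.
Qed.

(** * Enumeration of the avoiders, level by level *)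

Definition level (T : set (seq nat)) (n : nat) (s : seq dperm) : Prop :=
  [/\ sorted adjacent s, uniq (unzip1 s) &
      forall p, (p \in unzip1 s) <-> avoiders T n p].

(** Exact enumeration is carried in [level] for this count: it makes the index range in [gray_list]
    cover the whole previous list. *)
Lemma level_size T n s : level T n s -> size s = nb_avoiders T n.
Proof.
case=> _ us hs; rewrite -(size_map fst) /nb_avoiders; apply: perm_size.
apply: uniq_perm; rewrite ?filter_uniq ?permutations_uniq // => p.
rewrite mem_filter mem_permutations; apply/idP/andP => [/hs av|[/asboolP av _]].
  by split; [apply/asboolP | case: av].
exact/hs.
Qed.

Lemma level_phi T n s :
    (forall p, avoiders T n p -> tractable T p) ->
  level T n s -> level T n.+1 (flatten [seq phi T d | d <- s]).
Proof.
move=> good [srt us hs].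
have av d : d \in s -> avoiders T n d.1 by move=> ds; apply/hs; apply: map_f.
split.
- apply: (@flatten_phi_sorted _ n) => // d /av avd.
  by split; [apply: good | apply: avoiders_size avd].
- elim: s us av {srt hs} => [//|d s IHs] /= /andP[ds us] av.
  have avd := av d (mem_head _ _).
  rewrite /unzip1 map_cat cat_uniq (uniq_unzip1_phi (good _ avd) avd) IHs //; last first.
    by move=> e es; apply: av; rewrite inE es orbT.
  (* A child shared by two families would have both [d.1] and [e.1] as its parent, against
     distinctness at level [n]. *)
  rewrite andbT; apply/hasPn => x; rewrite map_flatten -map_comp.
  case/flatten_mapP => e es xe; apply: contra ds => xd.
  have ave : avoiders T n e.1 by apply: av; rewrite inE es orbT.
  have [_ <-] := (mem_unzip1_phi x (good _ avd) avd).1 xd.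
  have [_ ->] := (mem_unzip1_phi x (good _ ave) ave).1 xe.
  exact: map_f.
move=> p; rewrite /unzip1 map_flatten -map_comp; split.
  case/flatten_mapP => d ds pd.
  by have [] := (mem_unzip1_phi p (good _ (av _ ds)) (av _ ds)).1 pd.
move=> avp; have /hs/mapP[d ds ed] := remove_max_avoiders avp.
apply/flatten_mapP; exists d => //.
by apply/(mem_unzip1_phi p (good _ (av _ ds)) (av _ ds)).
Qed.

Lemma big_cat_flatten (I A : Type) (r : seq I) (F : I -> seq A) :
  \big[cat/[::]]_(i <- r) F i = flatten [seq F i | i <- r].
Proof. by elim: r => [|i r IHr]; rewrite ?big_nil // big_cons IHr. Qed.

(** The size bound ensures that no index falls back on the default [dperm0]. *)
Lemma gray_listS T n : 1 <= n -> nb_avoiders T n <= size (gray_list T n) ->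
  gray_list T n.+1 =
  flatten [seq phi T d | d <- take (nb_avoiders T n) (gray_list T n)].
Proof.
case: n => [//|n] _ le.
have -> : gray_list T n.+2 = \big[cat/[::]]_(1 <= q < (nb_avoiders T n.+1).+1)
            phi T (nth dperm0 (gray_list T n.+1) q.-1) by [].
rewrite big_add1 /=; set s := gray_list T n.+1 in le *; set m := nb_avoiders _ _ in le *.
rewrite -(map_nth_iota0 dperm0 le) -map_comp.
by rewrite big_cat_flatten /index_iota subn0.
Qed.

(** Repeated removal of the maximum ends at [[:: 1]]; hence if [[:: 1]] is not an avoider, no
    positive length has one. *)
Lemma avoiders1 T n p : 1 <= n -> avoiders T n p -> avoiders T 1 [:: 1].
Proof.
elim: n p => [//|[|n] IHn] p _ av; last exact: IHn (remove_max_avoiders av).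
have /perm_small_eq e := av.1; rewrite /= in e.
by rewrite -[[:: 1]]e.
Qed.

Lemma gray_list_level T n : regular T -> 1 <= n -> avoiders T 1 [:: 1] ->
  level T n (gray_list T n).
Proof.
case=> reg _ + av1; elim: n => [//|[|n] IHn] _.
  split=> // p; rewrite inE; split=> [/eqP -> //|[/perm_small_eq e _]].
  by apply/eqP; apply: e.
have lev := IHn isT; have sz := level_size lev.
rewrite gray_listS ?sz // -sz take_size; apply: level_phi lev => p.
exact: reg.
Qed.

Theorem theorem4p5 (T : set (seq nat)) (n : nat)
  (T_patterns : pattern_set T) (T_regular : regular T) (n_ge1 : 1 <= n)
  (q : nat) (q_lt : q.+1 < size (gray_list T n)) :
  nb_diff n (nth dperm0 (gray_list T n) q).1
            (nth dperm0 (gray_list T n) q.+1).1 <= 5.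
Proof.
have [av1|nav1] := pselect (avoiders T 1 [:: 1]).
  have [srt _ hs] := gray_list_level T_regular n_ge1 av1.
  have sz i : i < size (gray_list T n) -> size (nth dperm0 (gray_list T n) i).1 = n.
    by move=> hi; apply: (@avoiders_size T); apply/hs; apply: map_f; apply: mem_nth.
  rewrite nb_diffE ?sz //; last exact: ltnW.
  have /leq_trans -> // := sortedP dperm0 srt q q_lt.
  by case: (~~ _ && _).
(* Here [T] has a pattern of length at most 1. The list for length 1 is still a singleton by
   definition, without a pair, and all later lists are empty. *)
case: n n_ge1 q_lt => [//|[//|n]] _.
have e : nb_avoiders T n.+1 = 0.
  apply/eqP; rewrite /nb_avoiders size_filter -leqn0 leqNgt -has_count.
  by apply/hasPn => p _; apply/asboolP => /(@avoiders1 T n.+1 p isT).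
by rewrite gray_listS // e // take0.
Qed.
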